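(* Let $X_n=(\mathbb{C}^n,\|\cdot\|)$ be a Banach space and let $J\subset\mathbb{N}_0^n$ be an index set of degree at most $m$. Then $$\max_{0\le k\le m}\boldsymbol{\lambda}\big(\mathcal{P}_{J(k)}(X_n)\big)\le\boldsymbol{\lambda}\big(\mathcal{P}_J(X_n)\big)\le(m+1)\max_{0\le k\le m}\boldsymbol{\lambda}\big(\mathcal{P}_{J(k)}(X_n)\big).$$ In particular, for any Banach sequence lattice $X$, $$\lim_{m\to\infty}\sup_{n\in\mathbb{N}}\frac{\boldsymbol{\lambda}\big(\mathcal{P}_{\le m}(X_n)\big)^{1/m}}{\big(\max_{0\le k\le m}\boldsymbol{\lambda}(\mathcal{P}_k(X_n))\big)^{1/m}}=1.$$
   Context: $J(k)=\{\alpha\in J:|\alpha|=k\}$; $J$ has degree at most $m$ if $|\alpha|\le m$ for all $\alpha\in J$. $\mathcal{P}_J(X_n)$ is the space of polynomials $\sum_{\alpha\in J}c_\alpha z^\alpha$ on $\mathbb{C}^n$ with norm $\sup_{z\in B_{X_n}}|P(z)|$, $B_{X_n}$ the open unit ball; $\mathcal{P}_{\le m}$ and $\mathcal{P}_k$ correspond to $J=\{|\alpha|\le m\}$ and $J=\{|\alpha|=k\}$. $\boldsymbol{\lambda}$ is the projection constant. For a Banach sequence lattice $X$ (Banach space of complex sequences with the ideal property), $X_n$ is $\mathbb{C}^n$ with $\|z\|=\|\sum_{k\le n}|z_k|e_k\|_X$. *)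

(* Defs.v *)
From HB Require Import structures.
From mathcomp Require Import all_boot all_order all_algebra.
From mathcomp Require Import all_classical all_reals all_analysis.
From mathcomp Require Import complex.
Set Implicit Arguments. Unset Strict Implicit. Unset Printing Implicit Defensive.
Import Order.TTheory GRing.Theory Num.Theory.
Import numFieldNormedType.Exports.
Local Open Scope classical_set_scope.
Local Open Scope ring_scope.
Local Open Scope complex_scope.

Section Defs.
Variable R : realType.
Local Notation C := R[i].

Definition cabs (z : C) : R := ComplexField.Normc.normc z.

Definition is_norm (n : nat) (N : 'rV[C]_n -> R) : Prop :=
  [/\ forall x, 0 <= N x,
      forall x, N x = 0 -> x = 0,
      forall (a : C) x, N (a *: x) = cabs a * N x &
      forall x y, N (x + y) <= N x + N y].

Definition unit_ball (n : nat) (N : 'rV[C]_n -> R) : set 'rV[C]_n :=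
  [set z | N z < 1].

Definition mdeg (n : nat) (a : n.-tuple nat) : nat := \sum_(i < n) tnth a i.
Definition monom (n : nat) (a : n.-tuple nat) (z : 'rV[C]_n) : C :=
  \prod_(i < n) z ord0 i ^+ tnth a i.

Definition Jk (n : nat) (J : seq (n.-tuple nat)) (k : nat) : seq (n.-tuple nat) :=
  [seq a <- J | mdeg a == k].

Definition Jle (n m : nat) : seq (n.-tuple nat) :=
  [seq a <- [seq map_tuple (@nat_of_ord m.+1) t | t <- enum {: n.-tuple 'I_m.+1}]
     | (mdeg a <= m)%N].
Definition Jeq (n k : nat) : seq (n.-tuple nat) := Jk (Jle n k) k.

Definition polyspace (n : nat) (J : seq (n.-tuple nat)) : set ('rV[C]_n -> C) :=
  [set f | exists c : n.-tuple nat -> C,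
           f = fun z => \sum_(a <- undup J) c a * monom a z].

Definition supnorm (T : Type) (B : set T) (f : T -> C) : R :=
  sup [set cabs (f z) | z in B].

Definition relproj (Z : normedModType C) (W : set Z) : R :=
  inf [set M : R | 0 <= M /\ exists P : {linear Z -> Z},
         (forall z, W (P z)) /\ (forall w, W w -> P w = w) /\
         (forall z, `|P z| <= M%:C * `|z|)].

Definition projconst (T : Type) (Y : set (T -> C)) (nrm : (T -> C) -> R) : R :=
  sup [set r : R | exists (Z : normedModType C) (E : (T -> C) -> Z),
         [/\ forall (a : C) f g, Y f -> Y g ->
               E (fun t => a * f t + g t) = a *: E f + E g,
             forall f, Y f -> `|E f| = (nrm f)%:C &
             r = relproj (E @` Y)]].

Definition lambdaP (n : nat) (N : 'rV[C]_n -> R) (J : seq (n.-tuple nat)) : R :=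
  projconst (polyspace J) (supnorm (unit_ball N)).

Definition is_bsl (X : set (nat -> C)) (nX : (nat -> C) -> R) : Prop :=
  [/\ X (fun _ => 0) /\
        (forall (a : C) x y, X x -> X y -> X (fun k => a * x k + y k)),
      [/\ forall x, X x -> 0 <= nX x,
          forall x, X x -> nX x = 0 -> x = (fun _ => 0),
          forall (a : C) x, X x -> nX (fun k => a * x k) = cabs a * nX x &
          forall x y, X x -> X y -> nX (fun k => x k + y k) <= nX x + nX y],
      forall u : nat -> (nat -> C), (forall p, X (u p)) ->
        (forall e : R, 0 < e -> exists N0, forall p q, (N0 <= p)%N -> (N0 <= q)%N ->
             nX (fun k => u p k - u q k) < e) ->
        (exists2 x, X x & (fun p => nX (fun k => u p k - x k)) @ \oo --> 0),
      forall x y, X y -> (forall k, cabs (x k) <= cabs (y k)) -> (X x /\ nX x <= nX y) &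
      forall j, X (fun k => if k == j then 1 else 0)].

Definition Xn_norm (nX : (nat -> C) -> R) (n : nat) (z : 'rV[C]_n) : R :=
  nX (fun k => if insub k is Some i then (cabs (z ord0 i))%:C else 0).

End Defs.

(* Main.v *)
(** Let [B] be the unit ball and [L] the space of all bounded functions on [B].
    Since [L] is injective (Hahn-Banach at each point), the projection constant
    of a space of polynomials is the infimum of the norms of the projections of
    [L] onto it.  The map [f |-> 1/(m+1) sum_j w^(-jk) f(w^j z)], with [w] a
    primitive root of unity of order [m+1], is a contraction [Q_k] of [L] that
    extracts the [k]-homogeneous part of polynomials of degree at most [m].  If
    [P] projects onto [P_J] then [Q_k P] projects onto [P_J(k)]; if [P_k]
    projects onto [P_J(k)] for each [k] then [sum_k P_k Q_k] projects onto [P_J].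
    The limit follows because the ratio lies between [1] and [(m+1)^(1/m)]. *)

Require Import Defs.
From HB Require Import structures.
From mathcomp Require Import all_boot all_order all_algebra.
From mathcomp Require Import all_classical all_reals all_analysis.
From mathcomp Require Import complex.
From mathcomp Require Import cyclic separable ring lra.
From mathcomp Require cyclotomic.
Import Order.TTheory GRing.Theory Num.Theory.
Import numFieldNormedType.Exports.
Local Open Scope classical_set_scope.
Local Open Scope ring_scope.
Local Open Scope complex_scope.

(** * The Hahn-Banach theorem for complex seminorms *)

Section HahnBanach.
Set Implicit Arguments.
Unset Strict Implicit.
Variables (R : realType) (V : lmodType R[i]) (p : V -> R).
Hypothesis pD : forall x y, p (x + y) <= p x + p y.
Hypothesis pZ : forall (a : R[i]) x, p (a *: x) = cabs a * p x.

Lemma cabs_real (t : R) : cabs t%:C = `|t|.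
Proof. by rewrite /cabs /= expr0n addr0 sqrtr_sqr. Qed.

Lemma seminorm0 : p 0 = 0.
Proof. by rewrite -(scale0r (0 : V)) pZ -[0]/(0%:C) cabs_real normr0 mul0r. Qed.

Lemma seminormN x : p (- x) = p x.
Proof.
rewrite -scaleN1r pZ; have -> : -1 = (-1)%:C :> R[i] by rewrite rmorphN1.
by rewrite cabs_real normrN1 mul1r.
Qed.

Lemma seminormZ_gt0 (t : R) x : 0 < t -> t * p x = p (t%:C *: x).
Proof. by move=> t0; rewrite pZ cabs_real gtr0_norm. Qed.

(** A partial real-linear functional dominated by [p]. Single-valuedness is not demanded: two values
    at one point differ by a value at [0], which is at most [p 0 = 0]. *)
Definition real_graph (G : set (V * R)) : Prop :=
  [/\ G (0, 0),
      forall (t : R) u v, G u -> G v -> G (t%:C *: u.1 + v.1, t * u.2 + v.2) &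
      forall u, G u -> u.2 <= p u.1].

Lemma real_graphZ G (t : R) u :
  real_graph G -> G u -> G (t%:C *: u.1, t * u.2).
Proof.
by case=> G0 GL _ Gu; have := GL t _ _ Gu G0; rewrite /= !addr0.
Qed.

(** A value [c] at [v] is admissible when it lies between all [u.2 - p (u.1 - v)] and all
    [p (u.1 + v) - u.2]. By subadditivity every lower bound is below every upper one, so the
    supremum of the lower bounds works. *)
Lemma real_graph_extend G (v : V) : real_graph G ->
  exists2 G', real_graph G' /\ G `<=` G' & exists r, G' (v, r).
Proof.
move=> gG; have [G0 GL Gp] := gG.
pose A := [set u.2 - p (u.1 - v) | u in G].
have Aub u : G u -> ubound A (p (u.1 + v) - u.2).
  move=> Gu _ [w Gw <-].
  have := Gp _ (GL 1 _ _ Gu Gw); rewrite /= scale1r mul1r => h1.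
  have : p (u.1 + w.1) <= p (u.1 + v) + p (w.1 - v).
    by rewrite (le_trans _ (pD _ _)) // addrACA subrr addr0.
  by lra.
have A0 : A !=set0 by apply/image_nonempty; exists (0, 0).
have hsA : has_sup A by split=> //; eexists; exact: Aub G0.
pose c := sup A.
have cub u : G u -> c <= p (u.1 + v) - u.2 by move=> Gu; apply: ge_sup A0 (Aub _ Gu).
have clb u : G u -> u.2 - p (u.1 - v) <= c.
  by move=> Gu; apply: ub_le_sup; [case: hsA|exists u].
exists [set w | exists u t, G u /\ w = (u.1 + t%:C *: v, u.2 + t * c)]; last first.
  exists c; exists (0, 0), 1; split=> //.
  by rewrite /= scale1r mul1r !add0r.
split; last first.
  by move=> [x r] Gu; exists (x, r), 0; rewrite /= scale0r mul0r !addr0.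
split.
- by exists (0, 0), 0; rewrite /= scale0r mul0r !addr0.
- move=> t _ _ [u1 [t1 [Gu1 ->]]] [u2 [t2 [Gu2 ->]]].
  exists (t%:C *: u1.1 + u2.1, t * u1.2 + u2.2), (t * t1 + t2); split.
    exact: GL.
  rewrite /=; congr pair; last by ring.
  by rewrite rmorphD rmorphM scalerDl scalerDr scalerA addrACA.
- move=> _ [u [t [Gu ->]]] /=.
  (* Rescaling [u] by the inverse of [|t|] reduces to the coefficient [1] or [-1] of [v]: the upper
     bound on [c] serves [t > 0], the lower bound [t < 0]. *)
  have [t0|t0|->] := ltgtP t 0; last first.
  + by rewrite scale0r mul0r !addr0 Gp.
  + have := cub _ (real_graphZ t^-1 gG Gu); rewrite /= => h.
    have : t * c <= t * (p (t^-1%:C *: u.1 + v) - t^-1 * u.2) by rewrite ler_pM2l.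
    rewrite mulrBr mulrA divff ?gt_eqF // mul1r (seminormZ_gt0 _ t0).
    rewrite scalerDr scalerA -rmorphM divff ?gt_eqF // scale1r; lra.
  + have nt0 : 0 < - t by lra.
    have := clb _ (real_graphZ (- t)^-1 gG Gu); rewrite /= => h.
    have : (- t) * ((- t)^-1 * u.2 - p ((- t)^-1%:C *: u.1 - v)) <= (- t) * c.
      by rewrite ler_pM2l.
    rewrite mulrBr mulrA divff ?gt_eqF // mul1r (seminormZ_gt0 _ nt0).
    rewrite scalerBr scalerA -rmorphM divff ?gt_eqF // scale1r.
    by rewrite rmorphN scaleNr opprK; lra.
Qed.

Lemma hahn_banach_real G : real_graph G -> exists f : V -> R,
  [/\ forall (t : R) x y, f (t%:C *: x + y) = t * f x + f y,
      forall x, f x <= p x & forall u, G u -> f u.1 = u.2].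
Proof.
move=> gG.
pose P H := H = set0 \/ (real_graph H /\ G `<=` H).
have [H [PH Hmax]] : exists H, P H /\ forall B, H `<` B -> ~ P B.
  apply: Zorn_bigcup => F FP Ftot.
  have [[X0 [FX0 [x0 X0x0]]]|nF] := pselect (exists X, F X /\ X !=set0); last first.
    left; rewrite -subset0 => x [X FX Xx]; apply: nF; exists X; split=> //.
    by exists x.
  have good X x : F X -> X x -> real_graph X /\ G `<=` X.
    by move=> FX Xx; case: (FP _ FX) => // XE; rewrite XE in Xx.
  have [[X00 _ _] GX0] := good _ _ FX0 X0x0.
  right; split; last by move=> u /GX0 ?; exists X0.
  split.
  - by exists X0.
  - move=> t u v [X FX Xu] [Y FY Yv].
    have [XY|YX] := Ftot _ _ FX FY.
      by exists Y => //; case: (good _ _ FY Yv) => -[_ + _] _; apply=> //; apply: XY.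
    by exists X => //; case: (good _ _ FX Xu) => -[_ + _] _; apply=> //; apply: YX.
  - by move=> u [X FX Xu]; case: (good _ _ FX Xu) => -[_ _ +] _; apply.
have [H0|[gH GH]] := PH.
  exfalso; apply: (Hmax G); last by right; split.
  rewrite H0; split; first exact: sub0set.
  by case: gG => G0 _ _ /(_ _ G0).
have Htot v : exists r, H (v, r).
  have [H' [gH' HH'] [r H'r]] := real_graph_extend v gH.
  exists r; apply: contrapT => nHr.
  apply: (Hmax H'); first by split=> // /(_ _ H'r).
  by right; split=> //; exact: subset_trans HH'.
have [H0 HL Hp] := gH.
have Hle x r s : H (x, r) -> H (x, s) -> r <= s.
  move=> Hr Hs; have := Hp _ (HL (-1) _ _ Hs Hr); rewrite /=.
  rewrite rmorphN1 scaleN1r addNr seminorm0; lra.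
have Huniq x r s : H (x, r) -> H (x, s) -> r = s.
  by move=> Hr Hs; apply/eqP; rewrite eq_le (Hle x) ?(Hle x).
have [f Hf] := choice Htot.
exists f; split.
- by move=> t x y; apply: (Huniq (t%:C *: x + y)) => //; apply: (HL t (x, f x) (y, f y)).
- by move=> x; apply: (Hp (x, f x)).
- by move=> [x r] Gu /=; apply: (Huniq x) => //; apply: GH.
Qed.

(* A subspace with a functional on it is given by its graph, so that
   well-definedness is a consequence of domination by [p]. *)
Lemma hahn_banach (G : set (V * R[i])) :
  G (0, 0) ->
  (forall a u v, G u -> G v -> G (a *: u.1 + v.1, a * u.2 + v.2)) ->
  (forall u, G u -> cabs u.2 <= p u.1) ->
  exists F : V -> R[i],
  [/\ scalar F, forall x, cabs (F x) <= p x & forall u, G u -> F u.1 = u.2].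
Proof.
move=> G0 GL Gp.
have ReG (z : R[i]) : complex.Re z <= cabs z.
  case: z => a b; rewrite /cabs /=; apply: le_trans (ler_norm _) _.
  by rewrite -sqrtr_sqr ler_wsqrtr // lerDl sqr_ge0.
have [f [fL fp fG]] : exists f : V -> R,
  [/\ forall (t : R) x y, f (t%:C *: x + y) = t * f x + f y,
      forall x, f x <= p x &
      forall u, [set (u.1, complex.Re u.2) | u in G] u -> f u.1 = u.2].
  apply: hahn_banach_real; split.
  - by exists (0, 0).
  - move=> t _ _ [u Gu <-] [v Gv <-].
    exists (t%:C *: u.1 + v.1, t%:C * u.2 + v.2); first exact: GL.
    rewrite /=; congr pair; case: u.2 => a b; case: v.2 => c d /=.
    by rewrite mul0r subr0.
  - by move=> _ [u Gu <-]; apply: le_trans (ReG _) (Gp _ Gu).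
(* A complex functional is determined by its real part [f] through [F x = f x - i f (i x)]. *)
pose F x := f x +i* - f ('i *: x).
have f0 : f 0 = 0 by have := fL (-1) 0 0; rewrite scaler0 addr0; lra.
have fD x y : f (x + y) = f x + f y by have := fL 1 x y; rewrite scale1r mul1r.
have fZ t x : f (t%:C *: x) = t * f x by have := fL t x 0; rewrite !addr0 f0 addr0.
have fN x : f (- x) = - f x by have := fD x (- x); rewrite subrr f0; lra.
have FD x y : F (x + y) = F x + F y.
  by apply/eqP; rewrite eq_complex /F /= scalerDr !fD opprD !eqxx.
have FZr (t : R) x : F (t%:C *: x) = t%:C * F x.
  have iC : 'i *: (t%:C *: x) = t%:C *: ('i *: x) by rewrite !scalerA mulrC.
  apply/eqP; rewrite eq_complex /F /= iC !fZ.
  by apply/andP; split; apply/eqP; ring.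
have Fi x : F ('i *: x) = 'i * F x.
  apply/eqP; rewrite eq_complex /F /= scalerA -expr2 sqr_i.
  rewrite scaleN1r fN.
  by apply/andP; split; apply/eqP; ring.
have FL : scalar F.
  move=> a x y; rewrite FD; congr (_ + _).
  by rewrite {1}[a]complexE scalerDl FD FZr -scalerA Fi FZr mulrA -mulrDl -complexE.
have p_ge0 x : 0 <= p x.
  by have := pD x (- x); rewrite subrr seminorm0 seminormN; lra.
exists F; split=> //.
- move=> x; have [->|Fx0] := eqVneq (F x) 0.
    by rewrite -[0]/(0%:C) cabs_real normr0.
  (* The unimodular [a] rotates [F x] onto the positive axis, so that [cabs (F x) = f (a *: x) <= p
     (a *: x) = p x]. *)
  pose a := (F x)^* / (cabs (F x))%:C.
  have cF : cabs (F x) != 0.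
    by apply: contra_neq Fx0; apply: ComplexField.Normc.eq0_normc.
  have Ja (z : R[i]) : cabs z^* = cabs z by case: z => u v; rewrite /cabs /= sqrrN.
  have ca : cabs a = 1.
    rewrite /a /cabs ComplexField.Normc.normcM ComplexField.Normc.normcV -!/(cabs _).
    by rewrite Ja cabs_real ger0_norm ?sqrtr_ge0 // ?divff // /cabs; case: (F x) => *; exact: sqrtr_ge0.
  have aF : a * F x = (cabs (F x))%:C.
    rewrite /a mulrAC [_^* * _]mulrC -sqr_normc normc_def.
    have -> : Num.sqrt (complex.Re (F x) ^+ 2 + complex.Im (F x) ^+ 2) = cabs (F x).
      by rewrite /cabs; case: (F x).
    rewrite expr2 mulfK //; apply: contra_neq cF; exact: (@complexI R).
  rewrite -[p x]mul1r -ca -pZ; apply: le_trans (fp _).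
  have F0 : F 0 = 0 by rewrite /F scaler0 f0 oppr0.
  have : F (a *: x) = a * F x by have := FL a x 0; rewrite F0 !addr0.
  by rewrite aF => -[->].
- move=> [x c] Gu /=; have := fG _ (ex_intro2 _ _ _ Gu erefl) => /= fx.
  (* The graph contains [('i *: x, 'i * c)], and the real part of ['i * c] is minus the imaginary
     part of [c]. *)
  have Giu := GL 'i _ _ Gu G0; have := fG _ (ex_intro2 _ _ _ Giu erefl).
  rewrite /= !addr0 => fix_; apply/eqP; rewrite eq_complex /F /= fx fix_.
  by case: (c) => a b /=; rewrite mul0r mul1r sub0r opprK !eqxx.
Qed.

End HahnBanach.

(** * The normed space of bounded functions and its injectivity *)

Section BoundedFunctions.
Set Implicit Arguments.
Unset Strict Implicit.
Variable R : realType.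
Local Notation C := R[i].

Lemma cabsE (a : C) : `|a| = (cabs a)%:C.
Proof. by []. Qed.

Lemma cabs_ge0 (a : C) : 0 <= cabs a.
Proof. by rewrite -ler0c -cabsE normr_ge0. Qed.

Lemma cabs0 : cabs (0 : C) = 0.
Proof. by rewrite -[0]/(0%:C) cabs_real normr0. Qed.

Lemma cabs1 : cabs (1 : C) = 1.
Proof. by rewrite -[1]/(1%:C) cabs_real normr1. Qed.

Lemma cabs_eq0 (a : C) : cabs a = 0 -> a = 0.
Proof. exact: ComplexField.Normc.eq0_normc. Qed.

Lemma cabsM (a b : C) : cabs (a * b) = cabs a * cabs b.
Proof. exact: ComplexField.Normc.normcM. Qed.

Lemma cabsD (a b : C) : cabs (a + b) <= cabs a + cabs b.
Proof. by rewrite -lecR rmorphD -!cabsE ler_normD. Qed.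

Lemma cabsX (a : C) k : cabs (a ^+ k) = cabs a ^+ k.
Proof. by elim: k => [|k IH]; rewrite ?cabs1 // !exprS cabsM IH. Qed.

(** The norm of a complex normed module has values in [C]; suprema and infima are taken in [R]. *)
Definition rnorm (Z : normedModType C) (z : Z) : R := complex.Re `|z|.

Lemma rnormE (Z : normedModType C) (z : Z) : `|z| = (rnorm z)%:C.
Proof. by rewrite RRe_real // normr_real. Qed.

Lemma rnorm_ge0 (Z : normedModType C) (z : Z) : 0 <= rnorm z.
Proof. by rewrite -ler0c -rnormE. Qed.

Lemma rnormD (Z : normedModType C) (x y : Z) : rnorm (x + y) <= rnorm x + rnorm y.
Proof. by rewrite -lecR rmorphD /= -!rnormE ler_normD. Qed.

Lemma rnormZ (Z : normedModType C) (a : C) (x : Z) :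
  rnorm (a *: x) = cabs a * rnorm x.
Proof. by apply: complexI; rewrite rmorphM /= -!rnormE normrZ cabsE. Qed.

Lemma rnorm0 (Z : normedModType C) : rnorm (0 : Z) = 0.
Proof. by rewrite /rnorm normr0. Qed.

Lemma rnorm0_eq0 (Z : normedModType C) (x : Z) : rnorm x = 0 -> x = 0.
Proof. by move=> x0; apply/normr0_eq0; rewrite rnormE x0. Qed.

Lemma linear_bundle (U V : lmodType C) (f : U -> V) :
  linear f -> exists g : {linear U -> V}, g = f :> (U -> V).
Proof.
move=> fL; pose m := GRing.isLinear.Build _ _ _ _ f fL.
by pose g : {linear U -> V} := HB.pack f m; exists g.
Qed.

Section Space.
Variable S : Type.

Definition bounded_pred : {pred S -> C} :=
  fun f => `[< exists M : R, forall s, cabs (f s) <= M >].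

Lemma bounded_predP (f : S -> C) :
  reflect (exists M : R, forall s, cabs (f s) <= M) (f \in bounded_pred).
Proof. exact: asboolP. Qed.

Lemma bounded_submod_closed : GRing.submod_closed bounded_pred.
Proof.
split; first by apply/bounded_predP; exists 0 => s; rewrite cabs0.
move=> a f g /bounded_predP[M HM] /bounded_predP[M' HM'].
apply/bounded_predP; exists (cabs a * M + M') => s.
apply: le_trans (cabsD _ _) _; rewrite lerD //.
by rewrite cabsM ler_wpM2l // cabs_ge0.
Qed.

HB.instance Definition _ :=
  GRing.isSubmodClosed.Build C (S -> C) bounded_pred bounded_submod_closed.

Record bfun := BFun { bval :> S -> C ; _ : bval \in bounded_pred }.
HB.instance Definition _ := [isSub for bval].
HB.instance Definition _ := [Choice of bfun by <:].
HB.instance Definition _ := [SubChoice_isSubLmodule of bfun by <:].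

Lemma bfunP (f g : bfun) : (forall s, f s = g s) -> f = g.
Proof. by move=> fg; apply/val_inj/funext. Qed.

Lemma bfunD (f g : bfun) s : (f + g) s = f s + g s.
Proof. by []. Qed.

Lemma bfunZ a (f : bfun) s : (a *: f) s = a * f s.
Proof. by []. Qed.

Definition bnorm (f : bfun) : R := sup [set cabs (f s) | s in setT].

Lemma cabs_le_bnorm (f : bfun) s : cabs (f s) <= bnorm f.
Proof.
case: f => f /= fB; have /bounded_predP[M HM] := fB.
by apply: ub_le_sup; [exists M => _ [t _ <-]; exact: HM|exists s].
Qed.

Lemma bnorm_le (f : bfun) M : 0 <= M -> (forall s, cabs (f s) <= M) -> bnorm f <= M.
Proof.
(* If [S] is empty, the norm is the default value [0] of [sup]. *)
move=> M0 HM; have [[s _]|nS] := pselect ([set: S] !=set0).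
  by apply: ge_sup => [|_ [t _ <-] //]; exists (cabs (f s)), s.
rewrite /bnorm (_ : [set _ | _ in _] = set0) ?sup0 //.
by rewrite -subset0 => x [s Hs _]; apply: nS; exists s.
Qed.

Lemma bnorm_ge0 f : 0 <= bnorm f.
Proof.
have [[s _]|nS] := pselect ([set: S] !=set0).
  exact: le_trans (cabs_ge0 _) (cabs_le_bnorm f s).
rewrite /bnorm (_ : [set _ | _ in _] = set0) ?sup0 //.
by rewrite -subset0 => x [s Hs _]; apply: nS; exists s.
Qed.

Let norm (f : bfun) : C := (bnorm f)%:C.

Let normD f g : norm (f + g) <= norm f + norm g.
Proof.
rewrite /norm -rmorphD lecR bnorm_le ?addr_ge0 ?bnorm_ge0 // => s.
by apply: le_trans (cabsD _ _) _; rewrite lerD // cabs_le_bnorm.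
Qed.

Let normZ a f : norm (a *: f) = `|a| * norm f.
Proof.
rewrite /norm cabsE -rmorphM; congr _%:C; apply/eqP; rewrite eq_le.
have Zle b g : bnorm (b *: g) <= cabs b * bnorm g.
  rewrite bnorm_le ?mulr_ge0 ?bnorm_ge0 ?cabs_ge0 // => s.
  by rewrite bfunZ cabsM ler_wpM2l ?cabs_ge0 ?cabs_le_bnorm.
rewrite Zle /=; have [->|a0] := eqVneq a 0; first by rewrite cabs0 mul0r bnorm_ge0.
(* The reverse inequality is [Zle] for the inverse scalar. *)
have := Zle a^-1 (a *: f); rewrite scalerA mulVf // scale1r => h.
apply: le_trans (ler_wpM2l (cabs_ge0 a) h) _.
by rewrite mulrA -cabsM divff // cabs1 mul1r.
Qed.

Let norm0 f : norm f = 0 -> f = 0.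
Proof.
move=> [f0]; apply: bfunP => s; apply: cabs_eq0; apply/eqP.
by rewrite eq_le cabs_ge0 andbT -f0 cabs_le_bnorm.
Qed.

HB.instance Definition _ := Lmodule_isNormed.Build C bfun normD normZ norm0.

Lemma cabs_le_rnorm (f : bfun) s : cabs (f s) <= rnorm f.
Proof. exact: cabs_le_bnorm. Qed.

Lemma rnorm_bfun_le (f : bfun) M :
  0 <= M -> (forall s, cabs (f s) <= M) -> rnorm f <= M.
Proof. exact: bnorm_le. Qed.

(* Bounded functions form an injective space: Hahn-Banach applies pointwise. *)
Lemma bfun_injective (Z : normedModType C) (G : set (Z * bfun)) :
  G (0, 0) ->
  (forall (a : C) u v, G u -> G v -> G (a *: u.1 + v.1, a *: u.2 + v.2)) ->
  (forall u, G u -> rnorm u.2 <= rnorm u.1) ->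
  exists T : Z -> bfun,
  [/\ linear T, forall z, rnorm (T z) <= rnorm z & forall u, G u -> T u.1 = u.2].
Proof.
move=> G0 GL Gn.
have ext s : exists F : Z -> C, [/\ scalar F, forall z, cabs (F z) <= rnorm z &
    forall u, [set (u.1, u.2 s) | u in G] u -> F u.1 = u.2].
  apply: hahn_banach; first exact: rnormD.
  - exact: rnormZ.
  - by exists (0, 0).
  - move=> a _ _ [u Gu <-] [v Gv <-].
    by exists (a *: u.1 + v.1, a *: u.2 + v.2); first exact: GL.
  - by move=> _ [u Gu <-]; apply: le_trans (cabs_le_rnorm _ _) (Gn _ Gu).
have [F HF] := choice ext.
have FB z : (fun s => F s z) \in bounded_pred.
  by apply/bounded_predP; exists (rnorm z) => s; case: (HF s) => _ Fle _; exact: Fle.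
exists (fun z => BFun (FB z)); split.
- by move=> a x y; apply: bfunP => s; case: (HF s) => FL _ _; exact: FL.
- by move=> z; apply: rnorm_bfun_le => [|s]; [exact: rnorm_ge0|case: (HF s) => _ Fle _; exact: Fle].
- by move=> u Gu; apply: bfunP => s; case: (HF s) => _ _ /(_ (u.1, u.2 s)); apply; exists u.
Qed.

End Space.

Definition bounded_proj (Z : normedModType C) (W : set Z) (M : R) : Prop :=
  0 <= M /\ exists P : {linear Z -> Z},
    [/\ forall z, W (P z), forall w, W w -> P w = w &
        forall z, rnorm (P z) <= M * rnorm z].

Lemma relprojE (Z : normedModType C) (W : set Z) :
  relproj W = inf [set M | bounded_proj W M].
Proof.
rewrite /relproj; congr inf; apply/seteqP; split=> M [M0 [P]].
  move=> [PW [Pid PM]]; split=> //; exists P; split=> // z.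
  by rewrite -lecR rmorphM /= -!rnormE.
move=> [PW Pid PM]; split=> //; exists P; split=> //; split=> // z.
by rewrite !rnormE -rmorphM lecR.
Qed.

Lemma relproj_ge0 (Z : normedModType C) (W : set Z) : 0 <= relproj W.
Proof.
rewrite relprojE; have [h|h] := pselect ([set M | bounded_proj W M] !=set0).
  by apply: lb_le_inf => // M [].
by rewrite (_ : [set _ | _] = set0) ?inf0 // -subset0 => M HM; apply: h; exists M.
Qed.

Lemma relproj_le (Z : normedModType C) (W : set Z) M :
  bounded_proj W M -> relproj W <= M.
Proof. by move=> WM; rewrite relprojE; apply: ge_inf => //; exists 0 => ? []. Qed.

Lemma relproj_adherent (Z : normedModType C) (W : set Z) M0 e :
  bounded_proj W M0 -> 0 < e -> exists2 M, bounded_proj W M & M < relproj W + e.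
Proof.
move=> WM0 e0; rewrite relprojE; apply: inf_adherent => //.
by split; [exists M0|exists 0 => ? []].
Qed.

(** * Computing projection constants inside the bounded functions *)

Section ProjConst.
Variables (T : Type) (B : set T) (Y : set (T -> C)).

(** Total by a default: a function unbounded on [B] goes to [0]. On [Y] it is the true
    restriction. *)
Definition restr (f : T -> C) : bfun {t | B t} :=
  insubd (0 : bfun {t | B t}) (fun s => f (proj1_sig s)).

Hypothesis Y0 : Y (fun=> 0).
Hypothesis YL : forall (a : C) f g, Y f -> Y g -> Y (fun t => a * f t + g t).
Hypothesis Ybnd : forall f, Y f -> exists M : R, forall t, B t -> cabs (f t) <= M.

Lemma restrE f s : Y f -> restr f s = f (proj1_sig s).
Proof.
move=> /Ybnd [M HM]; rewrite /restr -[LHS]/(val (insubd _ _) s) insubdK //.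
by apply/bounded_predP; exists M => -[t Bt] /=; apply: HM.
Qed.

Lemma restr_linear (a : C) f g : Y f -> Y g ->
  restr (fun t => a * f t + g t) = a *: restr f + restr g.
Proof.
move=> Yf Yg; apply: bfunP => s.
by rewrite bfunD bfunZ !restrE //; apply: YL.
Qed.

Lemma rnorm_restr f : Y f -> rnorm (restr f) = supnorm B f.
Proof.
move=> Yf; rewrite -[rnorm _]/(bnorm _) /bnorm /supnorm; congr sup.
apply/seteqP; split => _ [s Hs <-].
  by exists (proj1_sig s); rewrite ?restrE //; case: s Hs.
by exists (exist _ s Hs); rewrite ?restrE.
Qed.

(* The supremum over all isometric embeddings is attained at the embedding
   into the bounded functions, because that space is injective. *)
Lemma projconst_restr M0 : bounded_proj (restr @` Y) M0 ->
  projconst Y (supnorm B) = relproj (restr @` Y).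
Proof.
move=> WM0; rewrite /projconst; set A := [set r | _].
have Aub : ubound A (relproj (restr @` Y)).
  move=> _ [Z [E [EL En ->]]].
  have nE f : Y f -> rnorm (E f) = supnorm B f.
    by move=> Yf; rewrite /rnorm En.
  have E_sub f g : Y f -> Y g -> E (fun t => -1 * f t + g t) = - E f + E g.
    by move=> Yf Yg; rewrite EL // scaleN1r.
  (* [restr] need not be injective on [Y], but [E] identifies the same functions, since both see
     only the supremum over [B]. *)
  have E_eq f g : Y f -> Y g -> restr f = restr g -> E f = E g.
    move=> Yf Yg fg; apply/esym/eqP; rewrite -subr_eq0 addrC; apply/eqP.
    have Yd : Y (fun t => -1 * f t + g t) by exact: YL.
    rewrite -E_sub //; apply: rnorm0_eq0; rewrite nE // -rnorm_restr //.
    by rewrite (@restr_linear (-1) f g) // fg scaleN1r addNr rnorm0.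
  (* Injectivity extends the isometry [E f |-> restr f] to a contraction on all of [Z]. *)
  have [Tz [TL Tn TG]] : exists Tz : Z -> bfun {t | B t},
     [/\ linear Tz, forall z, rnorm (Tz z) <= rnorm z &
         forall u, [set (E f, restr f) | f in Y] u -> Tz u.1 = u.2].
    apply: bfun_injective.
    - exists (fun=> 0) => //; congr pair; apply: rnorm0_eq0.
        rewrite nE // -rnorm_restr //.
        rewrite (_ : restr _ = 0) ?rnorm0 //.
        by apply: bfunP => s; rewrite restrE.
      by rewrite (_ : restr _ = 0) ?rnorm0 //; apply: bfunP => s; rewrite restrE.
    - move=> a _ _ [f Yf <-] [g Yg <-]; exists (fun t => a * f t + g t); first exact: YL.
      by rewrite EL // restr_linear.
    - by move=> _ [f Yf <-] /=; rewrite nE // rnorm_restr.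
  have /choice[G HG] (w : bfun {t | B t}) :
      exists f, (restr @` Y) w -> Y f /\ restr f = w.
    have [[f Yf fw]|nw] := pselect ((restr @` Y) w); first by exists f.
    by exists (fun=> 0).
  rewrite relprojE [leRHS]relprojE.
  (* The constant [M0] makes the set nonempty, so that its infimum is not a default value. *)
  apply: lb_le_inf; first by exists M0.
  move=> M [M_ge0 [P [PW Pid PM]]]; apply: ge_inf; first by exists 0 => ? [].
  split=> //.
  (* The projection [P] is transported to [Z]: go to bounded functions by [Tz], project, lift to [Y]
     by [G], return by [E]. Only [P] can increase the norm. *)
  pose Q z := E (G (P (Tz z))).
  have Qlin : linear Q.
    move=> a x y; rewrite /Q.
    have [Yx rx] := HG _ (PW (Tz x)); have [Yy ry] := HG _ (PW (Tz y)).
    have [Yz rz] := HG _ (PW (Tz (a *: x + y))).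
    rewrite -EL //; apply: E_eq => //; first exact: YL.
    by rewrite restr_linear // rx ry rz TL linearP.
  have [Q' Q'E] := linear_bundle Qlin; exists Q'; rewrite Q'E; split.
  - by move=> z; exists (G (P (Tz z))) => //; case: (HG _ (PW (Tz z))).
  - move=> _ [f Yf <-]; rewrite /Q (TG (E f, restr f)) /=; last by exists f.
    rewrite Pid; last by exists f.
    have [|Yg rg] := HG (restr f); first by exists f.
    exact: E_eq.
  - move=> z; have [Yg rg] := HG _ (PW (Tz z)).
    rewrite /Q nE // -rnorm_restr // rg; apply: le_trans (PM _) _.
    by rewrite ler_wpM2l.
have Amem : A (relproj (restr @` Y)).
  exists (bfun {t | B t}), restr; split=> //.
    by move=> *; apply: restr_linear.
  by move=> f Yf; rewrite rnormE rnorm_restr.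
apply/eqP; rewrite eq_le ge_sup //=; last by eexists; exact: Amem.
by apply: ub_le_sup => //; eexists; exact: Aub.
Qed.

End ProjConst.
End BoundedFunctions.

Section Polynomials.
Set Implicit Arguments.
Unset Strict Implicit.
Variable R : realType.
Local Notation C := R[i].

(** * Bounded projections onto finite-dimensional subspaces *)

Section FiniteDim.
Variables (V : lmodType C) (p : V -> R).
Hypothesis pD : forall x y, p (x + y) <= p x + p y.
Hypothesis pZ : forall (a : C) x, p (a *: x) = cabs a * p x.
Hypothesis p_ge0 : forall x, 0 <= p x.
Hypothesis p0_eq0 : forall x, p x = 0 -> x = 0.

(** Hahn-Banach extends [a *: u |-> a * p u] from the line through [u]; dividing by [p u] normalises
    it, with [K = 1 / p u]. *)
Lemma separating_functional (u : V) : u != 0 -> exists (f : V -> C) (K : R),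
  [/\ scalar f, 0 <= K, forall x, cabs (f x) <= K * p x & f u = 1].
Proof.
move=> u0; have pu0 : p u != 0 by apply: contra_neq u0; apply: p0_eq0.
have [F [FL Fp FG]] : exists F : V -> C, [/\ scalar F, forall x, cabs (F x) <= p x &
    forall w, [set (a *: u, a * (p u)%:C) | a in setT] w -> F w.1 = w.2].
  apply: hahn_banach => //.
  - by exists 0; rewrite // scale0r mul0r.
  - move=> a _ _ [b _ <-] [c _ <-]; exists (a * b + c) => //=.
    by rewrite scalerDl scalerA mulrDl mulrA.
  - by move=> _ [a _ <-] /=; rewrite cabsM cabs_real pZ ger0_norm.
exists (fun x => (p u)^-1%:C * F x), (p u)^-1; split.
- by move=> a x y; rewrite [F _]FL mulrDr mulrCA.
- by rewrite invr_ge0.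
- by move=> x; rewrite cabsM cabs_real ger0_norm ?invr_ge0 // ler_wpM2l ?invr_ge0.
- have := FG (1 *: u, 1 * (p u)%:C) (ex_intro2 _ _ 1 I erefl).
  by rewrite /= scale1r mul1r => ->; rewrite -rmorphM mulVf.
Qed.

(** Vectors are added one at a time, each by a rank-one correction of [P]. The last clause says that
    the range lies in the span of [s], expressed as membership in every subspace containing [s]. *)
Lemma finite_bounded_projection (s : seq V) : exists (P : V -> V) (K : R),
  [/\ linear P, 0 <= K /\ forall x, p (P x) <= K * p x,
      forall v, v \in s -> P v = v &
      forall W : set V, W 0 -> (forall a x y, W x -> W y -> W (a *: x + y)) ->
        (forall v, v \in s -> W v) -> forall x, W (P x)].
Proof.
elim: s => [|v s [P [K [PL [K0 PK] Pid PW]]]].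
  exists (fun=> 0), 0; split=> //; first by move=> a x y; rewrite scaler0 addr0.
  by split=> // x; rewrite mul0r (@seminorm0 _ _ p).
have [Pv|Pv] := eqVneq (v - P v) 0.
  exists P, K; split=> //.
    by move=> w; rewrite inE => /predU1P[->|/Pid //]; apply/esym/subr0_eq.
  move=> W W0 WL Ws; apply: PW => // w ws; by apply: Ws; rewrite inE ws orbT.
set u := v - P v.
have [f [L [fL L0 fp fu]]] := separating_functional Pv.
have f0 : f 0 = 0.
  by have := fL (-1) 0 0; rewrite scaler0 addr0 mulN1r addNr.
(* The correction sends [v] to [P v + f u *: u = v] and vanishes where [P x = x]. Its bound comes
   from [p (x - P x) <= (1 + K) * p x]. *)
exists (fun x => P x + f (x - P x) *: u), (K + L * (1 + K) * p u); split.
- move=> a x y; rewrite PL.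
  have -> : a *: x + y - (a *: P x + P y) = a *: (x - P x) + (y - P y).
    by rewrite scalerBr opprD addrACA.
  by rewrite [f _]fL [in RHS]scalerDr scalerDl -scalerA addrACA.
- split; first by rewrite addr_ge0 // mulr_ge0 // mulr_ge0 // addr_ge0.
  move=> x; apply: le_trans (pD _ _) _; rewrite pZ mulrDl lerD //.
  rewrite mulrAC ler_wpM2r //; apply: le_trans (fp _) _.
  rewrite -mulrA ler_wpM2l // mulrDl mul1r; apply: le_trans (pD _ _) _.
  by rewrite lerD2l (seminormN pZ).
- move=> w; rewrite inE => /predU1P[->|/Pid Pw].
    by rewrite -/u fu scale1r /u addrC subrK.
  by rewrite Pw subrr f0 scale0r addr0.
- move=> W W0 WL Ws x.
  have Ws' y : y \in s -> W y by move=> ys; apply: Ws; rewrite inE ys orbT.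
  have Wv : W v by apply: Ws; rewrite inE eqxx.
  have Wu : W u by rewrite /u addrC -scaleN1r; apply: (WL) => //; exact: PW.
  by rewrite addrC; apply: (WL) => //; exact: PW.
Qed.

End FiniteDim.

(** * Polynomials as bounded functions on the unit ball *)

Section Norm.
Variables (n : nat) (N : 'rV[C]_n -> R).
Hypothesis normN : is_norm N.

(* No compactness is needed: since the span of the other basis vectors has a
   bounded projection, Hahn-Banach gives a bounded functional vanishing on them
   and not on the [i]-th one, which must be the [i]-th coordinate. *)
Lemma coord_le_norm (i : 'I_n) :
  exists2 K : R, 0 <= K & forall z : 'rV[C]_n, cabs (z ord0 i) <= K * N z.
Proof.
have [N_ge0 N0_eq0 NZ ND] := normN.
pose e (j : 'I_n) : 'rV[C]_n := delta_mx ord0 j.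
have eE j k : e j ord0 k = (k == j)%:R by rewrite mxE eqxx.
have [P [K [PL [K0 PK] Pid PW]]] :=
  finite_bounded_projection ND NZ N_ge0 N0_eq0 [seq e j | j <- enum 'I_n & j != i].
(* The vectors with zero [i]-th coordinate form a subspace containing the other basis vectors, hence
   the range of [P]; so [P] cannot fix [e i]. *)
have Pi0 x : P x ord0 i = 0.
  apply: (PW [set x | x ord0 i = 0]) => /=; first by rewrite mxE.
    by move=> a y z yi zi; rewrite !mxE yi zi mulr0 addr0.
  move=> v /mapP[j]; rewrite mem_filter => /andP[ji _] ->.
  by rewrite eE eq_sym (negbTE ji).
have u0 : e i - P (e i) != 0.
  apply/eqP => /matrixP/(_ ord0 i); rewrite !mxE Pi0 !eqxx subr0.
  by move/eqP; rewrite oner_eq0.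
have [f [L [fL L0 fp fu]]] := separating_functional ND NZ N_ge0 N0_eq0 u0.
have P0 : P 0 = 0.
  by have := PL (-1) 0 0; rewrite scaler0 addr0 scaleN1r addNr.
have f0 : f 0 = 0.
  by have := fL (-1) 0 0; rewrite scaler0 addr0 mulN1r addNr.
pose g x := f (x - P x).
have gL : scalar g.
  move=> a x y; rewrite /g PL.
  have -> : a *: x + y - (a *: P x + P y) = a *: (x - P x) + (y - P y).
    by rewrite scalerBr opprD addrACA.
  exact: fL.
have g0 : g 0 = 0 by rewrite /g P0 subrr f0.
have ge j : g (e j) = (j == i)%:R.
  have [->|ji] := eqVneq j i; first by rewrite /g fu.
  rewrite /g Pid ?subrr //; apply/mapP; exists j => //.
  by rewrite mem_filter ji mem_enum.
have gE z : g z = z ord0 i.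
  rewrite [in LHS](row_sum_delta z).
  rewrite (_ : g _ = \sum_j z ord0 j * g (e j)).
    rewrite (bigD1 i) //= ge eqxx mulr1 big1 ?addr0 // => j ji.
    by rewrite ge (negbTE ji) mulr0.
  elim: (index_enum _) => [|j r IH]; first by rewrite !big_nil.
  by rewrite !big_cons [g _]gL IH.
exists (L * (1 + K)); first by rewrite mulr_ge0 // addr_ge0.
move=> z; rewrite -gE; apply: le_trans (fp _) _.
rewrite -mulrA ler_wpM2l // mulrDl mul1r; apply: le_trans (ND _ _) _.
by rewrite lerD2l (seminormN NZ).
Qed.

Let B := unit_ball N.

Lemma monom_bounded (a : n.-tuple nat) :
  exists M : R, forall z, B z -> cabs (monom a z) <= M.
Proof.
have /choice[K HK] (i : 'I_n) :
    exists K : R, 0 <= K /\ forall z : 'rV[C]_n, cabs (z ord0 i) <= K * N z.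
  by have [K K0 HK] := coord_le_norm i; exists K.
exists (\prod_(i < n) K i ^+ tnth a i) => z Bz; rewrite /monom.
rewrite (big_morph (@cabs R) (@cabsM R) (cabs1 R)); apply: ler_prod => i _.
rewrite cabs_ge0 cabsX lerXn2r ?nnegrE ?cabs_ge0 //; first by case: (HK i).
have [K0 /(_ z) h] := HK i; apply: le_trans h _.
by rewrite ler_piMr // ltW.
Qed.

Lemma polyspace0 (J : seq (n.-tuple nat)) : @polyspace R n J (fun=> 0).
Proof.
exists (fun=> 0); apply/funext => z; rewrite big1 // => a _.
by rewrite mul0r.
Qed.

Lemma polyspaceL (J : seq (n.-tuple nat)) (a : C) (f g : 'rV[C]_n -> C) : polyspace J f -> polyspace J g ->
  polyspace J (fun z => a * f z + g z).
Proof.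
move=> [c ->] [d ->]; exists (fun b => a * c b + d b); apply/funext => z.
by rewrite mulr_sumr -big_split; apply: eq_bigr => b _; rewrite mulrDl mulrA.
Qed.

Lemma monom_polyspace (J : seq (n.-tuple nat)) a :
  a \in J -> polyspace J (@monom R n a).
Proof.
move=> aJ; exists (fun b => (b == a)%:R); apply/funext => z.
rewrite (bigD1_seq a) ?mem_undup ?undup_uniq //= eqxx mul1r big1 ?addr0 //.
by move=> b /negbTE ->; rewrite mul0r.
Qed.

(** An induction principle that reduces linear statements about polynomials to monomials. *)
Lemma polyspace_ind (J : seq (n.-tuple nat)) (Q : set ('rV[C]_n -> C)) :
  Q (fun=> 0) ->
  (forall (a : C) f g, Q f -> Q g -> Q (fun z => a * f z + g z)) ->
  (forall a, a \in J -> Q (@monom R n a)) -> polyspace J `<=` Q.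
Proof.
move=> Q0 QL QJ _ [c ->].
have : {subset undup J <= J} by move=> a; rewrite mem_undup.
elim: (undup J) => [|a s IH] sJ.
  by rewrite (_ : (fun _ => _) = fun=> 0) //; apply/funext => z; rewrite big_nil.
rewrite (_ : (fun _ => _) =
    fun z => c a * monom a z + \sum_(b <- s) c b * monom b z); last first.
  by apply/funext => z; rewrite big_cons.
apply: QL; first by apply/QJ/sJ; rewrite inE eqxx.
by apply: IH => b bs; apply: sJ; rewrite inE bs orbT.
Qed.

Lemma polyspace_sub (J J' : seq (n.-tuple nat)) :
  {subset J <= J'} -> polyspace J `<=` @polyspace R n J'.
Proof.
move=> JJ'; apply: polyspace_ind; [exact: polyspace0|exact: polyspaceL|].
by move=> a /JJ' aJ'; apply: monom_polyspace.
Qed.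

Lemma polyspace_bounded (J : seq (n.-tuple nat)) (f : 'rV[C]_n -> C) :
  polyspace J f -> exists M : R, forall z, B z -> cabs (f z) <= M.
Proof.
move: f; apply: polyspace_ind => /=.
- by exists 0 => z _; rewrite -[leLHS]/(cabs (0 : C)) cabs0.
- move=> a f g [M HM] [M' HM']; exists (cabs a * M + M') => z Bz.
  apply: le_trans (cabsD _ _) _; rewrite lerD ?HM' //.
  by rewrite cabsM ler_wpM2l ?cabs_ge0 ?HM.
- by move=> a _; apply: monom_bounded.
Qed.

Definition ballpoly (J : seq (n.-tuple nat)) : set (bfun R {z | B z}) :=
  restr B @` polyspace J.

Lemma restr0 : restr B (fun=> 0 : C) = 0.
Proof.
apply: bfunP => s; rewrite (restrE (Y := polyspace [::])) //.
  exact: polyspace_bounded.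
exact: polyspace0.
Qed.

Lemma ballpoly0 J : ballpoly J 0.
Proof. by exists (fun=> 0); [exact: polyspace0|exact: restr0]. Qed.

Lemma ballpolyL J (a : C) u v : ballpoly J u -> ballpoly J v -> ballpoly J (a *: u + v).
Proof.
move=> [f Yf <-] [g Yg <-]; exists (fun z => a * f z + g z); first exact: polyspaceL.
by apply: (restr_linear (Y := polyspace J)) => //; [exact: polyspaceL|exact: polyspace_bounded].
Qed.

Lemma restr_monomE a s : restr B (@monom R n a) s = monom a (proj1_sig s).
Proof.
apply: (restrE (Y := polyspace [:: a])); first exact: polyspace_bounded.
by apply: monom_polyspace; rewrite inE.
Qed.

Lemma monom_ballpoly (J : seq (n.-tuple nat)) a :
  a \in J -> ballpoly J (restr B (@monom R n a)).
Proof. by move=> aJ; exists (@monom R n a) => //; apply: monom_polyspace. Qed.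

Lemma ballpoly_ind (J : seq (n.-tuple nat)) (Q : set (bfun R {z | B z})) :
  Q 0 -> (forall (a : C) u v, Q u -> Q v -> Q (a *: u + v)) ->
  (forall a, a \in J -> Q (restr B (@monom R n a))) -> ballpoly J `<=` Q.
Proof.
move=> Q0 QL QJ _ [f Yf <-].
suff: (polyspace J `&` [set f | Q (restr B f)]) f by case.
move: f Yf; apply: polyspace_ind => /=.
- by split; [exact: polyspace0|rewrite restr0].
- move=> a f g [Yf Qf] [Yg Qg]; split; first exact: polyspaceL.
  rewrite (restr_linear (Y := polyspace J)) //; first exact: QL.
    exact: polyspaceL.
  exact: polyspace_bounded.
- by move=> a aJ; split; [exact: monom_polyspace|exact: QJ].
Qed.

(** The space is spanned by finitely many monomials. This keeps [relproj] from being the infimum of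
    an empty set, whose default is [0]. *)
Lemma ballpoly_bounded_proj J : exists M, bounded_proj (ballpoly J) M.
Proof.
have [P [K [PL [K0 PK] Pid PW]]] :=
  finite_bounded_projection (@rnormD R _) (@rnormZ R _) (@rnorm_ge0 R _)
    (@rnorm0_eq0 R _) [seq restr B (@monom R n a) | a <- J].
exists K; split=> //.
have [P' P'E] := linear_bundle PL; exists P'; split=> [z|w|z]; rewrite ?P'E //.
  apply: PW; [exact: ballpoly0|exact: ballpolyL|].
  by move=> _ /mapP[a aJ ->]; apply: monom_ballpoly.
move: w; apply: ballpoly_ind => /=; first by rewrite -P'E linear0.
  by move=> a u v Pu Pv; rewrite PL Pu Pv.
by move=> a aJ; apply: Pid; apply: map_f.
Qed.

(** Puts the projection constants for all index sets into one ambient space, where projections can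
    be composed and added. *)
Lemma lambdaP_relproj J : lambdaP N J = relproj (ballpoly J).
Proof.
have [M HM] := ballpoly_bounded_proj J.
apply: projconst_restr HM; [exact: polyspace0|exact: polyspaceL|exact: polyspace_bounded].
Qed.

End Norm.
End Polynomials.

Arguments ballpoly {R n} N J.

(** * Extraction of homogeneous parts and the two inequalities *)

Section Homogeneous.
Set Implicit Arguments.
Unset Strict Implicit.
Variable R : realType.
Local Notation C := R[i].

(** Over the algebraically closed field [C] the separable polynomial [X^d - 1] has [d] distinct
    roots, and so many roots of unity of order dividing [d] include a primitive one. *)
Lemma primitive_root_exists (d : nat) :
  (0 < d)%N -> exists w : C, d.-primitive_root w.
Proof.
move=> d0; have [r] := closed_field_poly_normal ('X^d - 1 : {poly C}).
rewrite (monicP (monicXnsubC _ d0)) scale1r => rE.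
have /hasP[w _ ww] : has d.-primitive_root r; last by exists w.
apply: has_prim_root => //.
- by apply/allP => z; rewrite -root_prod_XsubC -rE.
- rewrite -separable_prod_XsubC -rE.
  by apply: cyclotomic.separable_Xn_sub_1; rewrite pnatr_eq0 -lt0n.
- by rewrite -ltnS -(size_prod_XsubC r id) -rE size_XnsubC.
Qed.

Lemma cabs_primitive_root (d : nat) (w : C) : d.-primitive_root w -> cabs w = 1.
Proof.
move=> ww; have := cabsX w d; rewrite (prim_expr_order ww) cabs1 => /esym/eqP.
by rewrite pexpr_eq1 ?(prim_order_gt0 ww) ?cabs_ge0 // => /eqP.
Qed.

(** A geometric sum with ratio [q]: for [a != k] below [d], [q != 1] but [q ^+ d = 1]. *)
Lemma sum_primitive_root (d : nat) (w : C) (a k : nat) :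
  d.-primitive_root w -> (a < d)%N -> (k < d)%N ->
  \sum_(j < d) (w ^+ a / w ^+ k) ^+ j = if a == k then d%:R else 0.
Proof.
move=> ww ad kd; have w0 : w != 0.
  apply/eqP => w0; have := cabs_primitive_root ww.
  by rewrite w0 cabs0 => /esym/eqP; rewrite oner_eq0.
have wk0 : w ^+ k != 0 by rewrite expf_neq0.
have [->|ak] := eqVneq a k.
  by rewrite divff // (eq_bigr (fun=> 1)) ?sumr_const ?card_ord // => j; rewrite expr1n.
set q := _ / _; have q1 : q - 1 != 0.
  rewrite subr_eq0; apply: contraNneq ak => q1; rewrite -(modn_small ad) -(modn_small kd).
  rewrite -(eq_prim_root_expr ww) -[w ^+ a](divfK wk0) -/q q1 mul1r //.
apply: (mulfI q1); rewrite -subrX1 mulr0 /q exprMn exprVn -!exprM ![(_ * d)%N]mulnC.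
by rewrite !exprM (prim_expr_order ww) !expr1n invr1 mulr1 subrr.
Qed.

Variables (n : nat) (N : 'rV[C]_n -> R).
Hypothesis normN : is_norm N.
Let B := unit_ball N.

Lemma monomZ (a : n.-tuple nat) (c : C) (z : 'rV[C]_n) :
  monom a (c *: z) = c ^+ mdeg a * monom a z.
Proof.
rewrite /monom /mdeg -prodrXr -big_split /=; apply: eq_bigr => i _.
by rewrite mxE exprMn.
Qed.

(* Cauchy's formula for the homogeneous part of degree [k], discretised at the
   roots of unity of order [m + 1] so that it makes sense, with norm one, on all
   bounded functions. *)
Lemma homogeneous_part (m k : nat) : (k <= m)%N ->
  exists Q : bfun R {z | B z} -> bfun R {z | B z},
  [/\ linear Q, forall f, rnorm (Q f) <= rnorm f &
      forall a, (mdeg a <= m)%N -> Q (restr B (@monom R n a)) =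
        if mdeg a == k then restr B (@monom R n a) else 0].
Proof.
move=> km; have [w ww] := primitive_root_exists (ltn0Sn m).
have w1 := cabs_primitive_root ww.
have Brot j z : B z -> B (w ^+ j *: z).
  have [_ _ NZ _] := normN.
  by rewrite /B /unit_ball /= NZ cabsX w1 expr1n mul1r.
pose rot j (s : {z | B z}) : {z | B z} :=
  exist _ (w ^+ j *: proj1_sig s) (Brot j _ (proj2_sig s)).
pose avg (f : bfun R {z | B z}) s : C :=
  m.+1%:R^-1 * \sum_(j < m.+1) (w ^+ k)^-1 ^+ j * f (rot j s).
have avg_le f s : cabs (avg f s) <= rnorm f.
  have cm : cabs (m.+1%:R^-1 : C) = m.+1%:R^-1.
    by rewrite -[m.+1%:R](rmorph_nat (real_complex R)) -fmorphV cabs_real ger0_norm ?invr_ge0.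
  rewrite /avg cabsM cm ler_pdivrMl ?ltr0n //.
  apply: le_trans (_ : _ <= \sum_(j < m.+1) rnorm f) _; last first.
    by rewrite sumr_const card_ord mulr_natl.
  elim/big_ind2 : _ => [|x1 x2 y1 y2 h1 h2|j _]; first by rewrite cabs0.
    by apply: le_trans (cabsD _ _) _; rewrite lerD.
  have ck : cabs (w ^+ k)^-1 = 1.
    by rewrite /cabs ComplexField.Normc.normcV -/(cabs _) cabsX w1 expr1n invr1.
  by rewrite cabsM cabsX ck expr1n mul1r cabs_le_rnorm.
have avgB f : avg f \in @bounded_pred R {z | B z}.
  by apply/bounded_predP; exists (rnorm f).
exists (fun f => BFun (avgB f)); split.
- move=> c f g; apply: bfunP => s.
  rewrite bfunD bfunZ -[LHS]/(avg _ s) -![BFun _ s]/(avg _ s) /avg mulrCA -mulrDr.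
  congr (_ * _); rewrite mulr_sumr -big_split; apply: eq_bigr => j _.
  by rewrite bfunD bfunZ mulrDr mulrCA.
- by move=> f; apply: rnorm_bfun_le; [exact: rnorm_ge0|exact: avg_le].
- move=> a am; apply: bfunP => s /=; rewrite /avg.
  (* By homogeneity the [j]-th rotation multiplies the monomial by [w ^+ (j * mdeg a)], which leaves
     the orthogonality sum as a factor. *)
  rewrite (_ : \sum_(j < _) _ =
      (\sum_(j < m.+1) (w ^+ mdeg a / w ^+ k) ^+ j) * monom a (proj1_sig s)).
    rewrite (sum_primitive_root ww) //; case: eqP => _.
      by rewrite mulrA mulVf ?pnatr_eq0 // mul1r restr_monomE.
    by rewrite mul0r mulr0.
  rewrite mulr_suml; apply: eq_bigr => j _.
  by rewrite restr_monomE //= monomZ mulrA -exprM mulnC exprM -exprMn mulrC [_^-1 * _]mulrC mulrC.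
Qed.

Variables (J : seq (n.-tuple nat)) (m : nat).
Hypothesis Jm : all (fun a => mdeg a <= m)%N J.

Lemma homogeneous_part_ballpoly (k : nat) : (k <= m)%N ->
  exists Q : bfun R {z | B z} -> bfun R {z | B z},
  [/\ linear Q, forall f, rnorm (Q f) <= rnorm f,
      forall f, ballpoly N J f -> ballpoly N (Jk J k) (Q f),
      forall f, ballpoly N (Jk J k) f -> Q f = f &
      forall a, a \in J -> Q (restr B (@monom R n a)) =
        if mdeg a == k then restr B (@monom R n a) else 0].
Proof.
move=> km; have [Q [QL Qn Qa]] := homogeneous_part km.
have Q0 : Q 0 = 0 by have [Q' Q'E] := linear_bundle QL; rewrite -Q'E linear0.
have JmE a : a \in J -> (mdeg a <= m)%N by move/(allP Jm).
exists Q; split=> //.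
- apply: ballpoly_ind => //=; first by rewrite Q0; apply: ballpoly0.
    by move=> a u v Qu Qv; rewrite QL; apply: ballpolyL.
  move=> a aJ; rewrite Qa ?JmE //; case: ifP => ak; last exact: ballpoly0.
  by apply: monom_ballpoly => //; rewrite mem_filter ak.
- apply: ballpoly_ind => //=.
    by move=> a u v Qu Qv; rewrite QL Qu Qv.
  by move=> a; rewrite mem_filter => /andP[ak aJ]; rewrite Qa ?JmE // ak.
- by move=> a aJ; rewrite Qa ?JmE.
Qed.

Lemma ballpoly_Jk k : ballpoly N (Jk J k) `<=` ballpoly N J.
Proof.
apply: ballpoly_ind; [exact: normN|exact: ballpoly0|exact: ballpolyL|].
by move=> a; rewrite mem_filter => /andP[_ aJ]; apply: monom_ballpoly.
Qed.

(** Composing with the contraction [Q] preserves the bound [M], so each constant admissible for [J]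
    is admissible for [Jk J k]. *)
Lemma lambdaP_Jk_le k : (k <= m)%N -> lambdaP N (Jk J k) <= lambdaP N J.
Proof.
move=> km; rewrite !lambdaP_relproj // [leRHS]relprojE.
have [Q [QL Qn QW Qid _]] := homogeneous_part_ballpoly km.
apply: lb_le_inf; first exact: ballpoly_bounded_proj.
move=> M [M0 [P [PW Pid PM]]]; apply: relproj_le; split=> //.
have QPL : linear (Q \o P) by move=> a x y; rewrite /= linearP QL.
have [P' P'E] := linear_bundle QPL; exists P'; rewrite P'E; split => /=.
- by move=> z; apply/QW/PW.
- by move=> w Ww; rewrite Pid ?Qid //; apply: ballpoly_Jk Ww.
- by move=> z; apply: le_trans (Qn _) (PM _).
Qed.

Lemma bounded_proj_sum (M : 'I_m.+1 -> R) :
  (forall k : 'I_m.+1, bounded_proj (ballpoly N (Jk J k)) (M k)) ->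
  bounded_proj (ballpoly N J) (\sum_k M k).
Proof.
move=> HM; split; first by apply: sumr_ge0 => k _; case: (HM k).
have /choice[P HP] (k : 'I_m.+1) : exists P : {linear bfun R {z | B z} -> bfun R {z | B z}},
    [/\ forall z, ballpoly N (Jk J k) (P z), forall w, ballpoly N (Jk J k) w -> P w = w &
        forall z, rnorm (P z) <= M k * rnorm z].
  by case: (HM k).
have /choice[Q HQ] (k : 'I_m.+1) := homogeneous_part_ballpoly (leq_ord k).
pose T f := \sum_k P k (Q k f).
have TL : linear T.
  move=> a x y; rewrite /T scaler_sumr -big_split; apply: eq_bigr => k _ /=.
  by case: (HQ k) => QL _ _ _ _; rewrite QL linearP.
have T0 : T 0 = 0 by have [T' T'E] := linear_bundle TL; rewrite -T'E linear0.
have [T' T'E] := linear_bundle TL; exists T'; rewrite T'E; split.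
- move=> z; rewrite /T; elim/big_ind : _ => [|x y Wx Wy|k _]; first exact: ballpoly0.
    by rewrite -[x]scale1r; apply: ballpolyL.
  by case: (HP k) => PW _ _; apply: ballpoly_Jk (PW _).
- apply: ballpoly_ind => //=; first by move=> a u v Tu Tv; rewrite TL Tu Tv.
  move=> a aJ; have am : (mdeg a < m.+1)%N by rewrite ltnS (allP Jm).
  (* On a monomial only the summand of its own degree survives, and there both maps fix it. *)
  rewrite /T (bigD1 (Ordinal am)) //= big1 ?addr0.
    case: (HQ (Ordinal am)) => _ _ _ _ -> //; rewrite eqxx.
    case: (HP (Ordinal am)) => _ -> //; apply: monom_ballpoly => //.
    by rewrite mem_filter eqxx.
  move=> k ka; case: (HQ k) => _ _ _ _ -> //; rewrite ifN ?linear0 //.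
  by apply: contra_neq ka => ak; apply: val_inj.
- move=> z; rewrite /T mulr_suml.
  elim/big_ind2 : _ => [|x1 x2 y1 y2 h1 h2|k _]; first by rewrite rnorm0.
    by apply: le_trans (rnormD _ _) _; rewrite lerD.
  case: (HP k) => _ _ Pn; case: (HQ k) => _ Qn _ _ _; apply: le_trans (Pn _) _.
  by rewrite ler_wpM2l //; case: (HM k).
Qed.

(** Makes the initial value [0] of the maxima harmless. *)
Lemma lambdaP_ge0 (J' : seq (n.-tuple nat)) : 0 <= lambdaP N J'.
Proof. by rewrite lambdaP_relproj // relproj_ge0. Qed.

Let M := \big[Num.max/0]_(k < m.+1) lambdaP N (Jk J k).

Lemma max_lambdaP_Jk_le : M <= lambdaP N J.
Proof.
by apply: bigmax_le => [|k _]; [exact: lambdaP_ge0|exact: lambdaP_Jk_le (leq_ord k)].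
Qed.

Lemma lambdaP_le_max : lambdaP N J <= m.+1%:R * M.
Proof.
apply/ler_addgt0Pr => e e0.
(* The infima need not be attained; each of the [m.+1] projections is chosen within [e / m.+1] of
   its infimum, for a total error [e]. *)
have e'0 : 0 < e / m.+1%:R by rewrite divr_gt0.
have /choice[K HK] (k : 'I_m.+1) : exists K : R,
    bounded_proj (ballpoly N (Jk J k)) K /\ K < lambdaP N (Jk J k) + e / m.+1%:R.
  have [M0 HM0] := ballpoly_bounded_proj normN (Jk J k).
  have [K HK Klt] := relproj_adherent HM0 e'0.
  by exists K; rewrite lambdaP_relproj.
have KW : bounded_proj (ballpoly N J) (\sum_k K k).
  by apply: bounded_proj_sum => k; case: (HK k).
rewrite lambdaP_relproj //; apply: le_trans (relproj_le KW) _.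
apply: le_trans (_ : _ <= \sum_(k < m.+1) (M + e / m.+1%:R)) _.
  apply: ler_sum => k _; case: (HK k) => _ /ltW h; apply: le_trans h _.
  by rewrite lerD2r /M; apply: (le_bigmax_cond _ (fun k : 'I_m.+1 => lambdaP N (Jk J k))).
by rewrite sumr_const card_ord -[leLHS]mulr_natl mulrDr mulrCA divff ?pnatr_eq0 // mulr1.
Qed.

End Homogeneous.

(** * Sequence lattices and the limit *)

Section SequenceLattice.
Set Implicit Arguments.
Unset Strict Implicit.
Variable R : realType.
Local Notation C := R[i].

(** A projection fixes [w], so its norm is at least [1]. *)
Lemma relproj_ge1 (Z : normedModType C) (W : set Z) M0 w :
  bounded_proj W M0 -> W w -> w != 0 -> 1 <= relproj W.
Proof.
move=> WM0 Ww w0; rewrite relprojE; apply: lb_le_inf; first by exists M0.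
move=> M [_ [P [_ Pid PM]]]; have := PM w; rewrite Pid // -[leLHS]mul1r ler_pM2r //.
by rewrite lt_def rnorm_ge0 andbT; apply: contra_neq w0; apply: rnorm0_eq0.
Qed.

Lemma mem_Jle n m (a : n.-tuple nat) : (a \in Jle n m) = (mdeg a <= m)%N.
Proof.
rewrite mem_filter andb_idr // => am; apply/mapP.
(* Each entry is at most the degree, so enumerating tuples over ['I_m.+1] misses no multi-index. *)
have aE i : (tnth a i < m.+1)%N.
  by rewrite ltnS; apply: leq_trans am; rewrite /mdeg (bigD1 i) //= leq_addr.
exists [tuple inord (tnth a i) | i < n]; first by rewrite mem_enum.
by apply: eq_from_tnth => i; rewrite tnth_map tnth_mktuple inordK.
Qed.

Lemma mem_Jeq n k (a : n.-tuple nat) : (a \in Jeq n k) = (mdeg a == k).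
Proof. by rewrite mem_filter mem_Jle andb_idr // => /eqP ->. Qed.

Lemma Jk_Jle n m k : (k <= m)%N -> Jk (Jle n m) k =i Jeq n k.
Proof.
by move=> km a; rewrite mem_Jeq mem_filter mem_Jle andb_idr // => /eqP ->.
Qed.

Lemma eq_lambdaP n (N : 'rV[C]_n -> R) J J' : J =i J' -> lambdaP N J = lambdaP N J'.
Proof.
move=> JJ'; rewrite /lambdaP; congr projconst.
by apply/seteqP; split; apply: polyspace_sub => a; rewrite JJ'.
Qed.

(** The constant [1] is a nonzero polynomial of degree [0] on the ball, as evaluation at the origin
    shows. This keeps the denominators of the ratio positive. *)
Lemma lambdaP_Jeq0_ge1 n (N : 'rV[C]_n -> R) : is_norm N -> 1 <= lambdaP N (Jeq n 0).
Proof.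
move=> normN; rewrite lambdaP_relproj //.
have [M0 HM0] := ballpoly_bounded_proj normN (Jeq n 0).
pose a : n.-tuple nat := [tuple 0%N | i < n].
have a0 : mdeg a = 0%N by rewrite /mdeg big1 // => i _; rewrite tnth_mktuple.
have aJ : a \in Jeq n 0 by rewrite mem_Jeq a0.
apply: (relproj_ge1 HM0 (monom_ballpoly N aJ)).
have N0 : unit_ball N 0.
  have [_ _ NZ _] := normN.
  by rewrite /unit_ball /= -(scale0r 0) NZ cabs0 mul0r ltr01.
apply/eqP => /(congr1 (fun f : bfun R {z | unit_ball N z} => f (exist _ 0 N0))).
rewrite restr_monomE //= /monom big1 => [|i _]; last by rewrite tnth_mktuple expr0.
by move/eqP; rewrite oner_eq0.
Qed.

Lemma lambdaP_Jle_bounds n (N : 'rV[C]_n -> R) m : is_norm N ->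
  let M := \big[Num.max/0]_(k < m.+1) lambdaP N (Jeq n k) in
  [/\ 1 <= M, M <= lambdaP N (Jle n m) & lambdaP N (Jle n m) <= m.+1%:R * M].
Proof.
move=> normN M.
have ME : M = \big[Num.max/0]_(k < m.+1) lambdaP N (Jk (Jle n m) k).
  by apply: eq_bigr => k _; apply: eq_lambdaP => a; rewrite (Jk_Jle (leq_ord k)).
have Jm : all (fun a => mdeg a <= m)%N (Jle n m) by apply/allP => a; rewrite mem_Jle.
split.
- apply: le_trans (lambdaP_Jeq0_ge1 normN) _.
  exact: (le_bigmax_cond _ (fun k : 'I_m.+1 => lambdaP N (Jeq n k)) (j := ord0)).
- by rewrite ME; apply: max_lambdaP_Jk_le.
- by rewrite ME; apply: lambdaP_le_max.
Qed.

Lemma Xn_norm_is_norm (X : set (nat -> C)) (nX : (nat -> C) -> R) n :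
  is_bsl X nX -> is_norm (Xn_norm nX (n := n)).
Proof.
move=> [[X0 XL] [nX_ge0 nX0 nXZ nXD] _ Xideal Xe].
pose ext (c : 'I_n -> C) (k : nat) : C := if insub k is Some i then c i else 0.
(* The extension by zero is a finite combination of unit vectors, hence belongs to [X]. *)
have extE c : ext c = fun k => \sum_(i < n) c i * (if k == i then 1 else 0).
  apply/funext => k; rewrite /ext; case: insubP => [i _ <-|kn].
    rewrite (bigD1 i) //= eqxx mulr1 big1 ?addr0 // => j ji.
    by rewrite ifN ?mulr0 // eq_sym.
  rewrite big1 // => i _; rewrite ifN ?mulr0 //.
  by apply: contraNneq kn => ->; exact: ltn_ord.
have Xext c : X (ext c).
  rewrite extE; elim: (index_enum _) => [|i r IH].
    by under eq_fun do rewrite big_nil.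
  by under eq_fun do rewrite big_cons; apply: XL.
have NE z : Xn_norm nX z = nX (ext (fun i => (cabs (z ord0 i))%:C)) by [].
split.
- by move=> z; rewrite NE; apply/nX_ge0.
- move=> z; rewrite NE => /(nX0 _ (Xext _)) z0; apply/rowP => i.
  have := congr1 (fun f => f (val i)) z0; rewrite /ext valK mxE => -[zi].
  exact: cabs_eq0.
- move=> a z; rewrite !NE -[cabs a]ger0_norm ?cabs_ge0 // -cabs_real -nXZ //.
  congr nX; apply/funext => k; rewrite /ext; case: insub => [i|]; last by rewrite mulr0.
  by rewrite mxE cabsM rmorphM.
- move=> z w; rewrite !NE; apply: le_trans _ (nXD _ _ (Xext _) (Xext _)).
  (* The ideal property turns the coordinatewise bound of [|z + w|] by [|z| + |w|] into an
     inequality of norms. *)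
  apply: (Xideal _ _ _ _).2.
    have := XL 1 _ _ (Xext (fun i => (cabs (z ord0 i))%:C)) (Xext (fun i => (cabs (w ord0 i))%:C)).
    by under eq_fun do rewrite mul1r.
  move=> k; rewrite /ext; case: insub => [i|]; last by rewrite addr0.
  rewrite -rmorphD !cabs_real !ger0_norm ?addr_ge0 ?cabs_ge0 //.
  by rewrite mxE cabsD.
Qed.

Lemma powR_succ_le (e : R) : 0 < e ->
  \forall m \near \oo, (m.+1%:R : R) `^ m%:R^-1 <= 1 + e.
Proof.
move=> e0; pose a := ln (1 + e).
have a0 : 0 < a by rewrite ln_gt0 // ltrDl.
near=> m.
have m0 : 0 < m%:R :> R by rewrite ltr0n; near: m; exact: nbhs_infty_gt.
have ma : 4 / a ^+ 2 <= m%:R by near: m; exact: nbhs_infty_ger.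
have le1 : m.+1%:R <= expR (a * m%:R) :> R.
  (* Linear growth of [expR] is too weak for small [a], so it is applied to half the exponent and
     squared; the term [a ^+ 2 * m ^+ 2 / 4] dominates [m] once [m >= 4 / a ^+ 2]. *)
  apply: le_trans (_ : _ <= (1 + a * m%:R / 2) ^+ 2) _.
    have : 4 <= a ^+ 2 * m%:R by rewrite mulrC -ler_pdivrMr // exprn_gt0.
    move=> /(ler_wpM2r (ltW m0)) h; have am0 : 0 < a * m%:R by exact: mulr_gt0.
    by rewrite -[m.+1%:R]natr1; nra.
  rewrite (_ : expR (a * m%:R) = expR (a * m%:R / 2) ^+ 2); last first.
    by rewrite -expRM_natl; congr expR; field.
  rewrite lerXn2r ?nnegrE ?expR_ge0 ?expR_ge1Dx //.
  by rewrite addr_ge0 // divr_ge0 // mulr_ge0 // ltW.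
apply: le_trans (_ : _ <= expR (a * m%:R) `^ m%:R^-1) _.
  by apply: ge0_ler_powR; rewrite ?nnegrE ?expR_ge0 ?invr_ge0 // ltW.
rewrite -expRM mulfK ?gt_eqF // lnK // posrE; lra.
Unshelve. all: by end_near. Qed.

Lemma sup_ratio_cvg (f g : nat -> nat -> R) :
  (forall m n, [/\ 1 <= g m n, g m n <= f m n & f m n <= m.+1%:R * g m n]) ->
  (fun m : nat => sup (range (fun n : nat => f m n `^ m%:R^-1 / g m n `^ m%:R^-1)))
    @ \oo --> (1 : R).
Proof.
move=> fg; apply/cvgrPdist_le => e e0; near=> m.
have mi : 0 <= m%:R^-1 :> R by rewrite invr_ge0.
have me : (m.+1%:R : R) `^ m%:R^-1 <= 1 + e by near: m; exact: powR_succ_le.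
rewrite /=; set A := (X in sup X).
have A1 n : 1 <= f m n `^ m%:R^-1 / g m n `^ m%:R^-1.
  have [g1 gf _] := fg m n; have g0 : 0 < g m n by apply: lt_le_trans g1.
  rewrite ler_pdivlMr ?powR_gt0 // mul1r ge0_ler_powR ?nnegrE ?(ltW g0) //.
  exact: le_trans (ltW g0) gf.
have Ae n : f m n `^ m%:R^-1 / g m n `^ m%:R^-1 <= 1 + e.
  have [g1 gf fmg] := fg m n; have g0 : 0 < g m n by apply: lt_le_trans g1.
  apply: le_trans me; rewrite ler_pdivrMr ?powR_gt0 // -powRM ?(ltW g0) //.
  by rewrite ge0_ler_powR ?nnegrE ?mulr_ge0 ?(ltW g0) // (le_trans (ltW g0) gf).
have supA : 1 <= sup A <= 1 + e.
  apply/andP; split.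
    apply: le_trans (A1 0%N) _; apply: ub_le_sup; last by exists 0%N.
    by exists (1 + e) => _ [n _ <-].
  by apply: ge_sup => [|_ [n _ <-] //]; eexists; exists 0%N.
by move: supA => /andP[s1 s2]; rewrite ler_norml; apply/andP; split; lra.
Unshelve. all: by end_near. Qed.

End SequenceLattice.

Theorem theorem2p4 (R : realType) :
  (forall (n : nat) (N : 'rV[R[i]]_n -> R) (J : seq (n.-tuple nat)) (m : nat),
     is_norm N -> all (fun a => mdeg a <= m)%N J ->
     let M := \big[Num.max/0]_(k < m.+1) lambdaP N (Jk J k) in
     M <= lambdaP N J /\ lambdaP N J <= m.+1%:R * M) /\
  (forall (X : set (nat -> R[i])) (nX : (nat -> R[i]) -> R),
     is_bsl X nX ->
     (fun m : nat =>
        sup (range (fun n : nat =>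
          lambdaP (Xn_norm nX (n := n.+1)) (Jle n.+1 m) `^ (m%:R^-1) /
          (\big[Num.max/0]_(k < m.+1) lambdaP (Xn_norm nX (n := n.+1)) (Jeq n.+1 k))
             `^ (m%:R^-1))))
       @ \oo --> (1 : R)).
Proof.
split=> [n N J m normN Jm M|X nX bslX].
  by split; [exact: max_lambdaP_Jk_le|exact: lambdaP_le_max].
apply: (sup_ratio_cvg (f := fun m n => lambdaP (Xn_norm nX (n := n.+1)) (Jle n.+1 m))
  (g := fun m n => \big[Num.max/0]_(k < m.+1)
     lambdaP (Xn_norm nX (n := n.+1)) (Jeq n.+1 k))) => m n.
exact: lambdaP_Jle_bounds (Xn_norm_is_norm _ bslX).
Qed.
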